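(* Let $0<p<1$ and $0<r<1$. For a network with generate-at-will packet arrivals over the Gilbert-Elliott erasure channel $GE(p,r)$, where under the first-come-first-served (FCFS) policy each new packet is generated as soon as the previous packet has been delivered, the average age of information is $$\bar\Delta_{wiF}=1+\frac{p}{r}+\frac{p}{r(p+r)}.$$
   Context: Time is slotted, $t=1,2,\dots$. Packets are generated at the beginning of a slot. At most one packet is transmitted per slot; a packet transmitted in slot $t$ and not erased is received at the end of slot $t$, i.e. is available at the receiver at the beginning of slot $t+1$. A packet may be transmitted in the same slot in which it is generated. Channel $GE(p,r)$: the channel state is a two-state Markov chain on $\{G,B\}$ (one step per slot) with transition probability $p$ from $G$ to $B$ and $r$ from $B$ to $G$. A transmission in a slot with state $G$ always succeeds (erasure probability $0$), and in a slot with state $B$ always fails (erasure probability $1$). Generate-at-will arrival: the transmitter can generate a packet whenever it wants. Under FCFS in this model, to avoid queuing, a packet is generated exactly when its predecessor is delivered: if a packet is delivered in slot $t$ (received at its end), the next packet is generated at the beginning of slot $t+1$ and is then transmitted repeatedly in every slot until it is successfully delivered (no preemption). The first packet is generated in slot $1$. Age of information (AoI): at the beginning of slot $t$, $\Delta_t=t-u_t$, where $u_t$ is the generation slot of the latest (most recently generated) packet received by the beginning of slot $t$. The average AoI is the long-run time average $\lim_{\tau\to\infty}\frac1\tau\sum_{t=1}^{\tau}\Delta_t$ (almost surely; the value assigned before the first delivery is irrelevant). *)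

(* Defs.v *)
From HB Require Import structures.
From mathcomp Require Import all_boot all_order all_algebra.
From mathcomp Require Import all_classical all_reals all_analysis.
Set Implicit Arguments.
Unset Strict Implicit.
Unset Printing Implicit Defensive.
Import Order.TTheory GRing.Theory Num.Theory.
Import numFieldNormedType.Exports.
Local Open Scope classical_set_scope.
Local Open Scope ring_scope.

(* Channel states are booleans: [true] is G (a transmission in the slot always
   succeeds), [false] is B (a transmission in the slot is always erased).
   A sample path of the channel is a function [nat -> bool] of the slot number;
   slots are numbered from 1, and the value at 0 plays no role. *)

Definition ge_trans (R : realType) (p r : R) (s s' : bool) : R :=
  if s then (if s' then 1 - p else p) else (if s' then r else 1 - r).

Definition cond_prob d (Omega : measurableType d) (R : realType)
    (P : probability Omega R) (A B : set Omega) : R :=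
  fine (P (A `&` B)) / fine (P B).

Definition history d (Omega : measurableType d) (X : nat -> Omega -> bool)
    (s : nat -> bool) (n : nat) : set Omega :=
  [set w | forall i, (1 <= i <= n)%N -> X i w = s i].

(* The initial distribution, i.e. the law of the state in slot 1, is
   arbitrary. *)
Definition gilbert_elliott d (Omega : measurableType d) (R : realType)
    (P : probability Omega R) (p r : R) (X : nat -> {RV P >-> bool}) : Prop :=
  forall (n : nat) (s : nat -> bool), (1 <= n)%N ->
    (0 < P (history X s n))%E ->
    cond_prob P [set w | X n.+1 w = s n.+1] (history X s n) =
    ge_trans p r (s n) (s n.+1).

(* Generation slot of the packet transmitted in slot [t >= 1], along the
   channel path [c]. The first packet is generated in slot 1; a packet is
   repeated until it is delivered, and a delivery in slot [t] makes the next
   packet be generated in slot [t.+1]. *)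
Fixpoint gen_slot (c : nat -> bool) (t : nat) : nat :=
  match t with
  | 0 => 1%N
  | t'.+1 => if (t' == 0)%N || c t' then t'.+1 else gen_slot c t'
  end.

(* Packets received by the beginning of slot [t] are those transmitted in a
   slot [s < t] in state G. *)
Definition latest_gen (c : nat -> bool) (t : nat) : nat :=
  \max_(1 <= s < t | c s) gen_slot c s.

(* [a0 t] is the value assigned to the age as long as nothing has been
   received. *)
Definition age (R : realType) (a0 : nat -> R) (c : nat -> bool) (t : nat) : R :=
  if has c (index_iota 1 t) then t%:R - (latest_gen c t)%:R else a0 t.

Definition time_average_age (R : realType) (a0 : nat -> R) (c : nat -> bool)
    (tau : nat) : R :=
  tau%:R^-1 * \sum_(1 <= t < tau.+1) age a0 c t.

(* Main.v *)
Require Import Defs.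
From HB Require Import structures.
From mathcomp Require Import all_boot all_order all_algebra.
From mathcomp Require Import all_classical all_reals all_analysis.
From mathcomp Require Import zify ring lra.
Set Implicit Arguments.
Unset Strict Implicit.
Unset Printing Implicit Defensive.
Import Order.TTheory GRing.Theory Num.Theory.
Import numFieldNormedType.Exports.
Local Open Scope classical_set_scope.
Local Open Scope ring_scope.

(* At the beginning of slot n+1 the age is u + v, where u is the number of slots
   since the last success and v the gap between the two last successes, and
   (u, v) is a Markov chain: it becomes (0, u+1) after a success and (u+1, v)
   after a failure. A solution h of the Poisson equation of this chain turns the
   centered sums S_n = sum of (age - mean) into a martingale S_n + h(u_n, v_n);
   a quadratic Lyapunov function bounds the second moments of u_n and v_n
   uniformly, hence E S_n^2 = O(n). Chebyshev's inequality and Borel-Cantelli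
   along n = k^4 give |S_n| < k^3 eventually, and monotonicity of the sums of
   ages fills the gaps. Expectations are finite sums over the words of length n,
   weighted by the probabilities of the corresponding channel histories. *)

(** * Ages along a fixed channel path *)

(* Newest slot first: [past c n = [:: c n; ...; c 1]]. *)
Fixpoint past (c : nat -> bool) (n : nat) : seq bool :=
  if n is n'.+1 then c n :: past c n' else [::].

Lemma size_past c n : size (past c n) = n.
Proof. by elim: n => //= n ->. Qed.

Lemma nth_past c n i : (i < n)%N -> nth false (past c n) i = c (n - i)%N.
Proof. by elim: n i => // n IH [|i] //= /IH ->. Qed.

(* [failures (past c n)] is the number of slots elapsed since the last success
   in slots 1 to n, and [prev_gap (past c n)] the distance between the last two
   successes; slot 0 counts as a (double) success. *)
Fixpoint failures (l : seq bool) : nat :=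
  if l is b :: l' then (if b then 0 else (failures l').+1)%N else 0%N.

Fixpoint prev_gap (l : seq bool) : nat :=
  if l is b :: l' then (if b then (failures l').+1 else prev_gap l') else 0%N.

Fixpoint age_sum (l : seq bool) : nat :=
  if l is b :: l' then (age_sum l' + (failures l' + prev_gap l'))%N else 0%N.

(** The packet in service was generated in the slot after the last success. *)
Lemma gen_slot_past c t :
  (gen_slot c t.+1 + failures (past c t) = t.+1)%N.
Proof.
elim: t => [|t IH] //.
have -> : gen_slot c t.+2 = if c t.+1 then t.+2 else gen_slot c t.+1 by [].
by rewrite /=; case: (c t.+1); [rewrite addn0 | rewrite addnS IH].
Qed.

(** The latest packet received was delivered at the last success and generated one slot after the
    success before it, whence the extra 1. Without any success the empty maximum is 0 and the extra
    1 disappears. *)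
Lemma latest_gen_past c t :
  (latest_gen c t.+1 + failures (past c t) + prev_gap (past c t)
   = t + has c (index_iota 1 t.+1))%N.
Proof.
elim: t => [|t IH]; first by rewrite /latest_gen big_geq.
have hS : has c (index_iota 1 t.+2) = c t.+1 || has c (index_iota 1 t.+1).
  have -> : index_iota 1 t.+2 = rcons (index_iota 1 t.+1) t.+1.
    by rewrite /index_iota !subSS !subn0 -[t.+1]addn1 iotaD cats1 add1n addn1.
  by rewrite has_rcons.
have lS : latest_gen c t.+2 =
    if c t.+1 then maxn (latest_gen c t.+1) (gen_slot c t.+1)
    else latest_gen c t.+1.
  rewrite /latest_gen big_mkcond big_nat_recr //= -big_mkcond.
  by case: ifP => _ //; rewrite maxn0.
have := gen_slot_past c t.
by rewrite hS lS /=; case: (c t.+1) => /=; lia.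
Qed.

Lemma age_past (R : realType) (a0 : nat -> R) c t :
  has c (index_iota 1 t.+1) ->
  age a0 c t.+1 = (failures (past c t) + prev_gap (past c t))%:R.
Proof.
move=> h; rewrite /age h; have := latest_gen_past c t; rewrite h => e.
rewrite -natrB; last by lia.
by congr (_%:R); lia.
Qed.

Lemma age_sum_past c n :
  age_sum (past c n) =
  (\sum_(0 <= t < n) (failures (past c t) + prev_gap (past c t)))%N.
Proof. by elim: n => [|n IH]; [rewrite big_geq | rewrite big_nat_recr //= -IH]. Qed.

Lemma age_sum_no_success c n : (forall t, (0 < t)%N -> ~~ c t) ->
  (age_sum (past c n) *2 = n * n.-1)%N.
Proof.
move=> h.
have f t : failures (past c t) = t /\ prev_gap (past c t) = 0%N.
  by elim: t => //= t [-> ->]; rewrite (negbTE (h t.+1 isT)).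
elim: n => //= n IH; have [-> ->] := f n; rewrite addn0 mulnDl IH.
by case: n {IH} => //= n; lia.
Qed.

(** * Elementary bounds on squares *)

(** Cauchy-Schwarz for [(a, b, c)] and [(u, v, 1)]; the three squares are those of Lagrange's
    identity. *)
Lemma linear_sq_le (R : realType) (a b c u v x : R) : x = a * u + b * v + c ->
  x ^+ 2 <= (a ^+ 2 + b ^+ 2 + c ^+ 2) * (u ^+ 2 + v ^+ 2 + 1).
Proof.
move=> ->.
have := sqr_ge0 (a * v - b * u); have := sqr_ge0 (a - c * u).
have := sqr_ge0 (b - c * v); nra.
Qed.

(** The cross term vanishes since the increment has mean zero, as for martingale differences. *)
Lemma centered_square (R : realType) (a1 a2 x y1 y2 : R) :
  0 <= a1 -> 0 <= a2 -> a1 + a2 = 1 -> a1 * y1 + a2 * y2 = 0 ->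
  a1 * (x + y1) ^+ 2 + a2 * (x + y2) ^+ 2 <= x ^+ 2 + (y1 ^+ 2 + y2 ^+ 2).
Proof.
move=> a1_ge0 a2_ge0 a12 ay.
have -> : a1 * (x + y1) ^+ 2 + a2 * (x + y2) ^+ 2 =
    (a1 + a2) * x ^+ 2 + 2 * x * (a1 * y1 + a2 * y2)
    + (a1 * y1 ^+ 2 + a2 * y2 ^+ 2) by ring.
rewrite a12 ay mul1r mulr0 addr0 lerD2l.
by apply: lerD; rewrite ler_piMl ?sqr_ge0 //; lra.
Qed.

(** * Poisson equation and Lyapunov drift *)

Section Corrector.
Context {R : realType} (p r : R).
Hypotheses (p01 : 0 < p < 1) (r01 : 0 < r < 1).

Definition mean_age : R := 1 + p / r + p / (r * (p + r)).

(* Solution of the Poisson equation [E h(next) - h = mean_age - age]. On failure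
   states it is the expected excess of age until the next success, plus the
   value [m v'] of the state reached there; it is linear, and [mean_age] is the
   constant that makes the equation hold on success states. *)
Definition corrector (u : nat) (v : R) : R :=
  let m := 1 + p / r in
  if u == 0%N then m * v
  else (r^-1 + m) * u%:R + r^-1 * v
       + ((1 - r) / r ^+ 2 - mean_age / r + m / r).

(** Change of [S_n + h(u_n, v_n)] over a slot whose channel state is [b]. *)
Definition increment (b : bool) (u : nat) (v : R) : R :=
  (if b then corrector 0 u.+1%:R else corrector u.+1 v)
  - corrector u v + (u%:R + v - mean_age).

(** The previous slot was in state G exactly when [u == 0], so the weights are the transition
    probabilities of the chain, and the identity is the Poisson equation. *)
Lemma increment_centered u v :
  Defs.ge_trans p r (u == 0%N) true * increment true u v +
  Defs.ge_trans p r (u == 0%N) false * increment false u v = 0.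
Proof.
have [r_gt0 _] := andP r01; have [p_gt0 _] := andP p01.
have r0 : r != 0 by rewrite gt_eqF.
have pr0 : p + r != 0 by rewrite gt_eqF // addr_gt0.
rewrite /increment /corrector /mean_age /Defs.ge_trans.
by case: u => [|u] /=; field; rewrite r0 pr0.
Qed.

Lemma increment_sq_le : exists2 K, 0 <= K & forall u v,
  increment true u v ^+ 2 + increment false u v ^+ 2 <=
  K * (u%:R ^+ 2 + v ^+ 2 + 1).
Proof.
set m := 1 + p / r; set A := r^-1 + m.
set C := (1 - r) / r ^+ 2 - mean_age / r + m / r.
pose N (a b c : R) := a ^+ 2 + b ^+ 2 + c ^+ 2.
have N_ge0 a b c : 0 <= N a b c by rewrite /N !addr_ge0 ?sqr_ge0.
(* Both increments are affine in [u] and [v], with one set of coefficients for [u = 0] ([K0]) and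
   another for [u > 0] ([K1]). *)
pose K0 := N 0 (1 - m) (m - mean_age) + N 0 (r^-1 - m + 1) (A + C - mean_age).
pose K1 := N (m - A + 1) (1 - r^-1) (m - C - mean_age) + N 1 1 (A - mean_age).
have K0_ge0 : 0 <= K0 by apply: addr_ge0; exact: N_ge0.
have K1_ge0 : 0 <= K1 by apply: addr_ge0; exact: N_ge0.
exists (K0 + K1) => [|u v]; first exact: addr_ge0.
have q_ge0 : 0 <= u%:R ^+ 2 + v ^+ 2 + 1 by rewrite !addr_ge0 ?sqr_ge0.
case: u q_ge0 => [|u] q_ge0.
  apply: (@le_trans _ _ (K0 * ((0%:R) ^+ 2 + v ^+ 2 + 1))); last first.
    by rewrite ler_wpM2r // lerDl.
  rewrite [K0 * _]mulrDl; apply: lerD.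
    by apply: linear_sq_le; rewrite /increment /corrector /= -/m; ring.
  by apply: linear_sq_le; rewrite /increment /corrector /= -/m -/A -/C; ring.
apply: (@le_trans _ _ (K1 * (u.+1%:R ^+ 2 + v ^+ 2 + 1))); last first.
  by rewrite ler_wpM2r // lerDr.
rewrite [K1 * _]mulrDl; apply: lerD.
  by apply: linear_sq_le; rewrite /increment /corrector /= -/m -/A -/C; ring.
by apply: linear_sq_le; rewrite /increment /corrector /= -/m -/A -/C; ring.
Qed.

Lemma corrector_sq_le : exists2 K, 0 <= K & forall u v,
  corrector u v ^+ 2 <= K * (u%:R ^+ 2 + v ^+ 2 + 1).
Proof.
set m := 1 + p / r.
set A := r^-1 + m; set C := (1 - r) / r ^+ 2 - mean_age / r + m / r.
pose K0 := 0 ^+ 2 + m ^+ 2 + 0 ^+ 2.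
pose K1 := A ^+ 2 + r^-1 ^+ 2 + C ^+ 2.
have K0_ge0 : 0 <= K0 by rewrite !addr_ge0 ?sqr_ge0.
have K1_ge0 : 0 <= K1 by rewrite !addr_ge0 ?sqr_ge0.
exists (K0 + K1) => [|u v]; first by rewrite addr_ge0.
have q_ge0 : 0 <= u%:R ^+ 2 + v ^+ 2 + 1 by rewrite !addr_ge0 ?sqr_ge0.
rewrite mulrDl /corrector; case: ifP => _.
  apply: ler_wpDr; first by rewrite mulr_ge0.
  by apply: linear_sq_le; rewrite mul0r add0r addr0.
by apply: ler_wpDl; [rewrite mulr_ge0 | exact: linear_sq_le].
Qed.

Definition energy (u v : R) : R := 2 * u ^+ 2 + v ^+ 2.

Lemma energy_ge0 u v : 0 <= energy u v.
Proof. by apply: addr_ge0; rewrite ?sqr_ge0 // mulr_ge0 ?sqr_ge0. Qed.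

(* The weight 2 makes a success, which turns [u] into the new [v], decrease the
   energy. *)
Lemma energy_drift : exists2 c, 0 < c & exists2 K, 0 <= K &
  forall (u : nat) (v : R),
  Defs.ge_trans p r (u == 0%N) true * energy 0 u.+1%:R +
  Defs.ge_trans p r (u == 0%N) false * energy u.+1%:R v <=
  energy u%:R v - c * (u%:R ^+ 2 + v ^+ 2 + 1) + K.
Proof.
have [r_gt0 r_lt1] := andP r01; have [p_gt0 p_lt1] := andP p01.
(* This rate is below [1 - p], the decay rate of [v ^+ 2] when [u = 0], and below [r / 2], what is
   left of the decay rate of [u ^+ 2] when [u > 0]. *)
exists (r * (1 - p) / 2); first by rewrite divr_gt0 // mulr_gt0 // subr_gt0.
have rp : 0 <= r * p by rewrite mulr_ge0 ?ltW.
have rp1 : 0 <= r * (1 - p) by apply: mulr_ge0; lra.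
exists (8 / r + 4) => [|u v]; first by rewrite addr_ge0 // divr_ge0 // ltW.
rewrite /energy /Defs.ge_trans; case: u => [|u] /=.
  have v2 := sqr_ge0 v.
  have : 0 <= (1 - p) * (1 - r) * v ^+ 2 by apply: mulr_ge0 => //; apply: mulr_ge0; lra.
  have : 0 <= 8 / r by rewrite divr_ge0 // ltW.
  nra.
rewrite -(natr1 u.+1); set x := u.+1%:R.
have x_ge0 : 0 <= x by rewrite ler0n.
(* The drift contains a linear term of at most [4 * x]; completing the square absorbs it into half
   of the decrease [r * x ^+ 2]. *)
have h1 : 4 * x <= r / 2 * x ^+ 2 + 8 / r.
  rewrite -subr_ge0.
  have -> : r / 2 * x ^+ 2 + 8 / r - 4 * x = (r * x - 4) ^+ 2 / (2 * r).
    by field; rewrite gt_eqF.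
  by rewrite divr_ge0 ?sqr_ge0 // mulr_ge0 // ltW.
have x2 := sqr_ge0 x; have v2 := sqr_ge0 v.
have : 0 <= r * p * x ^+ 2 by rewrite mulr_ge0.
have : 0 <= r * p * v ^+ 2 by rewrite mulr_ge0.
have : 0 <= r * v ^+ 2 by rewrite mulr_ge0 // ltW.
have : 0 <= r * x by rewrite mulr_ge0 // ltW.
nra.
Qed.

End Corrector.

(** * Expectations as weighted sums over words *)

Fixpoint words (n : nat) : seq (seq bool) :=
  if n is n'.+1 then map (cons true) (words n') ++ map (cons false) (words n')
  else [:: [::]].

Lemma mem_words n l : (l \in words n) = (size l == n).
Proof.
elim: n l => [|n IH] l; first by case: l.
rewrite mem_cat; case: l => [|b l].
  by apply/negP => /orP [] /mapP [].
rewrite /= eqSS -IH; apply/idP/idP => [/orP [] /mapP [x ? [_ ->]] //|h].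
by case: b; apply/orP; [left | right]; apply/mapP; exists l.
Qed.

Section WordExpectation.
Context {R : realType} (p r : R) (mu : seq bool -> R).
Hypotheses (p01 : 0 < p < 1) (r01 : 0 < r < 1).
Hypotheses (mu_nil : mu [::] = 1) (mu_ge0 : forall l, 0 <= mu l).
Hypothesis mu_cons : forall b l, l != [::] ->
  mu (b :: l) = mu l * Defs.ge_trans p r (head true l) b.
Hypothesis mu_split : forall l, mu (true :: l) + mu (false :: l) = mu l.

Definition word_expect (n : nat) (F : seq bool -> R) : R :=
  \sum_(l <- words n) mu l * F l.

Lemma word_expectS n F : word_expect n.+1 F =
  \sum_(l <- words n) (mu (true :: l) * F (true :: l)
                       + mu (false :: l) * F (false :: l)).
Proof. by rewrite big_split /word_expect big_cat !big_map. Qed.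

Lemma word_expect1 n : word_expect n (fun=> 1) = 1.
Proof.
elim: n => [|n IH]; first by rewrite /word_expect big_seq1 mu_nil mulr1.
rewrite word_expectS -[RHS]IH; apply: eq_bigr => l _.
by rewrite !mulr1 mu_split.
Qed.

Lemma word_expect_le n F G : (forall l, size l = n -> F l <= G l) ->
  word_expect n F <= word_expect n G.
Proof.
move=> FG; rewrite /word_expect !big_seq; apply: ler_sum => l.
by rewrite mem_words => /eqP sl; rewrite ler_wpM2l // FG.
Qed.

Lemma word_expectDl n F a b :
  word_expect n (fun l => a * F l + b) = a * word_expect n F + b.
Proof.
rewrite -[b in RHS]mulr1 -(word_expect1 n) /word_expect !big_distrr -big_split /=.
by apply: eq_bigr => l _ /=; ring.
Qed.

(** The induction starts at length 1 because the law of the first letter is arbitrary; transitions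
    govern only the later ones. *)
Lemma word_expect_drift F K : 0 <= K ->
  (forall l, l != [::] ->
    Defs.ge_trans p r (head true l) true * F (true :: l) +
    Defs.ge_trans p r (head true l) false * F (false :: l) <= F l + K) ->
  forall n, word_expect n.+1 F <= word_expect 1 F + K * n%:R.
Proof.
move=> K0 step; elim=> [|n IH]; first by rewrite mulr0 addr0.
rewrite -natr1 mulrDr mulr1 addrA; apply: (le_trans _ (lerD IH (lexx K))).
rewrite word_expectS -[word_expect n.+1 F]mul1r -word_expectDl.
rewrite /word_expect !big_seq; apply: ler_sum => l.
rewrite mem_words => /eqP sl.
have l0 : l != [::] by case: l sl.
by rewrite !mu_cons // -!mulrA -mulrDr ler_wpM2l // mul1r step.
Qed.

Let u l : R := (failures l)%:R.
Let v l : R := (prev_gap l)%:R.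
Let centered l : R := (age_sum l)%:R - mean_age p r * (size l)%:R.
Let martingale l : R := centered l + corrector p r (failures l) (v l).

Lemma martingale_cons b l : martingale (b :: l) =
  martingale l + increment p r b (failures l) (v l).
Proof.
rewrite /martingale /centered /increment /v /= -natr1 !natrD.
by case: b => /=; ring.
Qed.

Lemma word_expect_centered_sq : exists2 K, 0 <= K & forall n,
  word_expect n.+1 (fun l => ((age_sum l)%:R - mean_age p r * n.+1%:R) ^+ 2)
  <= K * n.+1%:R.
Proof.
have [K1 K1_ge0 incK] := increment_sq_le p r.
have [K2 K2_ge0 corK] := corrector_sq_le p r.
have [c c_gt0 [K3 K3_ge0 driftK]] := energy_drift p01 r01.
(* The quotient makes [a * c] at least [K1]; the added 1 gives [1 <= a], so that [a * energy] also
   dominates [energy]. *)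
pose a := K1 / c + 1.
have a_ge1 : 1 <= a by rewrite /a lerDr divr_ge0 // ltW.
have a_ge0 : 0 <= a by exact: le_trans a_ge1.
have ac : a * c = K1 + c by rewrite /a mulrDl mul1r divfK ?gt_eqF.
(* The drift of [a * energy] pays for the variance of the increments. *)
pose W l := martingale l ^+ 2 + a * energy (u l) (v l).
have step l : l != [::] ->
    Defs.ge_trans p r (head true l) true * W (true :: l) +
    Defs.ge_trans p r (head true l) false * W (false :: l) <= W l + a * K3.
  move=> l0; have -> : head true l = (failures l == 0%N) by case: l l0 => [|[]].
  rewrite /W !martingale_cons.
  set s := failures l == 0%N.
  have sum1 : Defs.ge_trans p r s true + Defs.ge_trans p r s false = 1.
    by rewrite /Defs.ge_trans; case: (s); ring.
  have tr_ge0 b : 0 <= Defs.ge_trans p r s b.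
    by move: p01 r01; rewrite /Defs.ge_trans; case: (s); case: b; lra.
  have := centered_square (martingale l) (tr_ge0 true) (tr_ge0 false) sum1
    (increment_centered p01 r01 (failures l) (v l)).
  have := incK (failures l) (v l).
  have := ler_wpM2l a_ge0 (driftK (failures l) (v l)).
  have expand e q : a * (e - c * q + K3) = a * e - K1 * q - c * q + a * K3.
    by rewrite -[K1](addrK c) -ac; ring.
  rewrite -/s -/(u l) expand.
  have -> : u (true :: l) = 0 by [].
  have -> : v (true :: l) = (failures l).+1%:R by [].
  have -> : u (false :: l) = (failures l).+1%:R by [].
  have -> : v (false :: l) = v l by [].
  have : 0 <= c * (u l ^+ 2 + v l ^+ 2 + 1).
    by rewrite pmulr_rge0 // !addr_ge0 ?sqr_ge0.
  lra.
have aK3 : 0 <= a * K3 by rewrite mulr_ge0.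
have W_ge0 l : 0 <= W l.
  by rewrite /W; apply: addr_ge0; rewrite ?sqr_ge0 // mulr_ge0 ?energy_ge0.
have E1_ge0 : 0 <= word_expect 1 W.
  by rewrite /word_expect sumr_ge0 // => l _; rewrite mulr_ge0.
(* From [(x - y)^2 <= 2 x^2 + 2 y^2], where the squared corrector [y^2] is at most
   [K2 * (a * energy + 1)]. *)
pose b := 2 * (1 + K2); pose K0 := word_expect 1 W + a * K3.
have b_ge0 : 0 <= b by apply: mulr_ge0 => //; exact: addr_ge0.
have K0_ge0 : 0 <= K0 by exact: addr_ge0.
exists (b * K0 + b) => [|n]; first by apply: addr_ge0 => //; exact: mulr_ge0.
have hE : word_expect n.+1 W <= K0 * n.+1%:R.
  apply: le_trans (word_expect_drift aK3 step n) _.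
  rewrite /K0 (mulrDl (word_expect 1 W)); apply: lerD; first by rewrite ler_peMr // ler1n.
  by rewrite ler_wpM2l // ler_nat.
apply: (@le_trans _ _ (b * word_expect n.+1 W + b)); last first.
  rewrite (mulrDl (b * K0)) -(mulrA b K0).
  apply: lerD; first by rewrite ler_wpM2l.
  by rewrite ler_peMr // ler1n.
rewrite -word_expectDl; apply: word_expect_le => l sl.
have -> : (age_sum l)%:R - mean_age p r * n.+1%:R =
    martingale l - corrector p r (failures l) (v l).
  by rewrite /martingale /centered sl; ring.
set x := martingale l; set y := corrector _ _ _ _.
have h1 : (x - y) ^+ 2 <= 2 * x ^+ 2 + 2 * y ^+ 2.
  by have := sqr_ge0 (x + y); lra.
have h2 : y ^+ 2 <= K2 * (a * energy (u l) (v l) + 1).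
  apply: le_trans (corK _ _) _; rewrite ler_wpM2l // lerD2r -/(u l).
  apply: (@le_trans _ _ (energy (u l) (v l))).
    by rewrite /energy; have := sqr_ge0 (u l); lra.
  by rewrite ler_peMl ?energy_ge0.
have e_ge0 : 0 <= a * energy (u l) (v l).
  by rewrite mulr_ge0 ?energy_ge0.
have x2 : 0 <= K2 * x ^+ 2 by rewrite mulr_ge0 ?sqr_ge0.
by rewrite /b /W -/x; lra.
Qed.

End WordExpectation.

(** * Convergence of averages along one path *)

Section Interpolation.
Context {R : realType}.

(* A block [k^4, (k+1)^4) has length O(k^3), the size of the error allowed at
   its endpoints, and this is o(k^4). *)
Lemma average_cvg_fourth_powers (T : nat -> nat) (a : R) : 0 <= a ->
  {homo T : m n / (m <= n)%N} ->
  (exists k0, forall k, (k0 <= k)%N ->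
    `|(T (k ^ 4)%N)%:R - a * (k ^ 4)%N%:R| <= k%:R ^+ 3) ->
  (n%:R^-1 * (T n)%:R) @[n --> \oo] --> a.
Proof.
move=> a_ge0 Tmono [k0 Tk]; apply/cvgrPdist_le => e e_gt0.
(* For [x >= 1], [(x + 1)^4 - x^4 <= 15 x^3] and [(x + 1)^3 <= 8 x^3]. The choice of [k1] then gives
   [B * x^3 <= e * x^4]. *)
pose B := 15 * a + 8.
pose k1 := maxn k0 (Num.truncn (B / e)).+1.
exists (k1 ^ 4)%N => // n /= nk1.
(* [k] will be the integer part of the fourth root of [n]. *)
have exk : exists k, (k ^ 4 <= n)%N by exists 0%N.
have ubk k : (k ^ 4 <= n)%N -> (k <= n)%N.
  by apply: leq_trans; case: k => // k; rewrite -[leqLHS]expn1 leq_pexp2l.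
case: (ex_maxnP exk ubk) => k kn kmax.
have k1k : (k1 <= k)%N by exact: kmax.
have k0k : (k0 <= k)%N by apply: leq_trans k1k; rewrite leq_maxl.
have k_gt0 : (0 < k)%N by apply: leq_trans k1k; rewrite leq_max orbT.
have nk : (n <= k.+1 ^ 4)%N.
  by rewrite ltnW // ltnNge; apply/negP => /kmax; rewrite ltnn.
have /andP [lo _] : - k%:R ^+ 3 <= (T (k ^ 4)%N)%:R - a * (k ^ 4)%N%:R <= k%:R ^+ 3.
  by rewrite -ler_norml Tk.
have /andP [_ hi] : - k.+1%:R ^+ 3 <=
    (T (k.+1 ^ 4)%N)%:R - a * (k.+1 ^ 4)%N%:R <= k.+1%:R ^+ 3.
  by rewrite -ler_norml Tk // leqW.
have Tlo : (T (k ^ 4)%N)%:R <= (T n)%:R :> R by rewrite ler_nat Tmono.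
have Thi : (T n)%:R <= (T (k.+1 ^ 4)%N)%:R :> R by rewrite ler_nat Tmono.
have nlo : a * (k ^ 4)%N%:R <= a * n%:R by rewrite ler_wpM2l // ler_nat.
have nhi : a * n%:R <= a * (k.+1 ^ 4)%N%:R by rewrite ler_wpM2l // ler_nat.
have x_ge1 : 1 <= k%:R :> R by rewrite ler1n.
have n_gt0 : 0 < n%:R :> R by rewrite ltr0n (leq_trans _ kn) // expn_gt0 k_gt0.
have xn : k%:R ^+ 4 <= n%:R :> R by rewrite -natrX ler_nat.
move: hi lo nlo nhi; rewrite !natrX -(natr1 k); set x : R := k%:R in x_ge1 xn *.
move=> hi lo nlo nhi.
have x2 : 1 <= x ^+ 2 by rewrite expr_ge1 // (le_trans ler01).
have x23 : x ^+ 2 <= x ^+ 3 by rewrite exprS ler_peMl // (le_trans ler01).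
have x12 : x <= x ^+ 2 by rewrite expr2 ler_peMl // (le_trans ler01).
have c3 : (x + 1) ^+ 3 <= 8 * x ^+ 3.
  have -> : (x + 1) ^+ 3 = x ^+ 3 + 3 * x ^+ 2 + 3 * x + 1 by ring.
  lra.
have c4 : a * (x + 1) ^+ 4 <= a * x ^+ 4 + 15 * a * x ^+ 3.
  have -> : (x + 1) ^+ 4 = x ^+ 4 + (4 * x ^+ 3 + 6 * x ^+ 2 + 4 * x + 1) by ring.
  rewrite mulrDr lerD2l [15 * a]mulrC -mulrA ler_wpM2l //; lra.
have x3_ge0 : 0 <= x ^+ 3 by lra.
have main : `|a * n%:R - (T n)%:R| <= B * x ^+ 3.
  by rewrite ler_norml /B; apply/andP; split; lra.
have -> : a - n%:R^-1 * (T n)%:R = n%:R^-1 * (a * n%:R - (T n)%:R).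
  by field; rewrite gt_eqF.
rewrite normrM gtr0_norm ?invr_gt0 // mulrC ler_pdivrMr //.
apply: (le_trans main); apply: (@le_trans _ _ (e * x ^+ 4)); last first.
  by rewrite ler_pM2l.
have Bx : B <= e * x.
  rewrite mulrC -ler_pdivrMr //; apply/ltW/(lt_le_trans (truncnS_gt _)).
  by rewrite /x ler_nat (leq_trans _ k1k) // leq_maxr.
by rewrite [x ^+ 4]exprS (mulrA e) ler_wpM2r.
Qed.

Lemma inv_nat_cvg0 : (n%:R^-1 : R) @[n --> \oo] --> (0 : R).
Proof. by rewrite -cvg_shiftS; exact: cvg_harmonic. Qed.

(** With no success the age would grow linearly and its average could not converge. *)
Lemma exists_success (c : nat -> bool) (a : R) :
  (n%:R^-1 * (age_sum (past c n))%:R) @[n --> \oo] --> a ->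
  exists2 t, (0 < t)%N & c t.
Proof.
move=> /cvgrPdist_le /(_ 1 ltr01) [N _ hN]; apply: contrapT => noc.
have c0 t : (0 < t)%N -> ~~ c t.
  by move=> t0; apply/negP => ct; apply: noc; exists t.
(* Large enough for the average [(n - 1) / 2] to exceed [|a| + 1]. *)
pose n := (N + (Num.truncn (2 * `|a| + 3)).+1)%N.
have := hN n (leq_addr _ _).
have n_gt : 2 * `|a| + 3 < n%:R.
  by apply: (lt_le_trans (truncnS_gt _)); rewrite ler_nat leq_addl.
have n_gt0 : (0 < n)%N by rewrite /n addnS.
have e : (age_sum (past c n))%:R * 2 = n%:R * (n%:R - 1) :> R.
  by rewrite -natrM age_sum_no_success // natrM -[n in n%:R - 1]prednK // -natr1 addrK.
have -> : n%:R^-1 * (age_sum (past c n))%:R = (n%:R - 1) / 2 :> R.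
  apply: (@mulIf _ 2); first by rewrite pnatr_eq0.
  rewrite -mulrA e mulrA mulVf ?pnatr_eq0 -?lt0n // mul1r.
  by rewrite -mulrA mulVf ?mulr1 ?pnatr_eq0.
rewrite ler_norml => /andP [lo _]; have := ler_norm a; lra.
Qed.

(** From the first success on, [age] equals [u + v], so [a0] enters only through a fixed finite sum
    [D], and [D / n] tends to 0. *)
Lemma time_average_age_cvg (a0 : nat -> R) (c : nat -> bool) (a : R) :
  (n%:R^-1 * (age_sum (past c n))%:R) @[n --> \oo] --> a ->
  time_average_age a0 c n @[n --> \oo] --> a.
Proof.
move=> h; have [t0 t0_gt0 ct0] := exists_success h.
pose f t : R := age a0 c t.+1 - (failures (past c t) + prev_gap (past c t))%:R.
have f0 t : (t0 <= t)%N -> f t = 0.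
  move=> t0t; rewrite /f age_past ?subrr //; apply/hasP; exists t0 => //.
  by rewrite mem_index_iota t0_gt0 ltnS.
pose D := \sum_(0 <= t < t0) f t.
have eqf : \forall n \near \oo,
    n%:R^-1 * (age_sum (past c n))%:R + n%:R^-1 * D = time_average_age a0 c n.
  exists t0 => // n /= t0n; rewrite -mulrDr /time_average_age; congr (_ * _).
  have -> : D = \sum_(0 <= t < n) f t.
    rewrite (@big_cat_nat _ _ _ t0) //= [X in _ + X]big_nat_cond.
    rewrite [X in _ + X]big1 ?addr0 //.
    by move=> t; rewrite andbT => /andP [/f0].
  rewrite age_sum_past natr_sum -big_split big_add1 /=.
  by apply: eq_bigr => t _; rewrite /f addrC subrK.
apply: cvg_trans (near_eq_cvg eqf) _.
have : n%:R^-1 * (age_sum (past c n))%:R + n%:R^-1 * D @[n --> \oo] --> a + 0 * D.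
  by apply: cvgD => //; apply: cvgMl; exact: inv_nat_cvg0.
by rewrite mul0r addr0.
Qed.

End Interpolation.

(** * The law of the channel histories *)

Section PathMeasure.
Context {R : realType} {d : measure_display} {Omega : measurableType d}
  {P : probability Omega R} (X : nat -> {RV P >-> bool}).

Definition cylinder (l : seq bool) : set Omega :=
  [set w | past (fun t => X t w) (size l) = l].

Definition cylinder_weight (l : seq bool) : R := fine (P (cylinder l)).

Lemma cylinder_cons b l :
  cylinder (b :: l) = cylinder l `&` [set w | X (size l).+1 w = b].
Proof.
by apply/seteqP; split => w; rewrite /cylinder /=; [case=> -> -> | case=> -> ->].
Qed.

Lemma measurable_state t b : measurable [set w | X t w = b].
Proof. exact: (measurable_funPTI (X t) (Y := [set b])). Qed.

Lemma measurable_cylinder l : measurable (cylinder l).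
Proof.
elim: l => [|b l IH].
  rewrite (_ : cylinder _ = setT); first exact: measurableT.
  by apply/seteqP; split.
by rewrite cylinder_cons; apply: measurableI => //; exact: measurable_state.
Qed.

Lemma cylinder_weightE l : P (cylinder l) = (cylinder_weight l)%:E.
Proof. by rewrite fineK // fin_num_measure //; exact: measurable_cylinder. Qed.

Lemma cylinder_weight_ge0 l : 0 <= cylinder_weight l.
Proof. by rewrite fine_ge0. Qed.

Lemma cylinder_weight_nil : cylinder_weight [::] = 1.
Proof.
rewrite /cylinder_weight (_ : cylinder _ = setT) ?probability_setT //.
by apply/seteqP; split.
Qed.

Lemma cylinder_weight_split l :
  cylinder_weight (true :: l) + cylinder_weight (false :: l) =
  cylinder_weight l.
Proof.
apply: EFin_inj; rewrite EFinD -!cylinder_weightE !cylinder_cons addeC.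
rewrite [RHS](measureDI _ (measurable_cylinder l)
  (measurable_state (size l).+1 true)); congr (P _ + _)%E.
apply/seteqP; split => w /= [? h]; split => //; first by rewrite h.
by case: (X _ w) h.
Qed.

(** [s] lists [b :: l] in chronological order. The history stops before the letter [b], which is the
    next state in the Markov property. *)
Lemma history_cylinder b l (s : nat -> bool) :
  (forall i, (i <= size l)%N -> s i.+1 = nth false (b :: l) (size l - i)) ->
  history (fun t w => X t w) s (size l) = cylinder l.
Proof.
move=> hs; apply/seteqP; split => w.
  move=> h; apply: (@eq_from_nth _ false); first by rewrite size_past.
  move=> i; rewrite size_past => il; rewrite nth_past // h; last by lia.
  have e : (size l - i = (size l - i.+1).+1)%N by lia.
  rewrite e hs; last by lia.
  by rewrite (_ : size l - (size l - i.+1) = i.+1)%N //; lia.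
move=> h.
have hn k : (k < size l)%N -> X (size l - k)%N w = nth false l k.
  by move=> kl; rewrite -[in RHS]h nth_past.
move=> [|i] //= il; rewrite hs; last by lia.
have -> : (size l - i = (size l - i.+1).+1)%N by lia.
rewrite /= -hn; last by lia.
by rewrite (_ : size l - (size l - i.+1) = i.+1)%N //; lia.
Qed.

Lemma cylinder_weight_cons (p r : R) b l : gilbert_elliott p r X ->
  l != [::] ->
  cylinder_weight (b :: l) = cylinder_weight l * Defs.ge_trans p r (head true l) b.
Proof.
move=> ge l0; pose s i := nth false (b :: l) ((size l).+1 - i).
have l_gt0 : (0 < size l)%N by case: l l0 {s}.
have hist : history (fun t w => X t w) s (size l) = cylinder l.
  by apply: (@history_cylinder b) => i il; rewrite /s subSS.
(* Nothing can be conditioned on a null history, but then both its extensions are null as well. *)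
have [w0|w0] := eqVneq (cylinder_weight l) 0.
  have := cylinder_weight_split l; rewrite w0 mul0r.
  have := cylinder_weight_ge0 (true :: l); have := cylinder_weight_ge0 (false :: l).
  by case: b {s hist}; lra.
have wpos : (0 < P (history (fun t w => X t w) s (size l)))%E.
  by rewrite hist cylinder_weightE lte_fin lt_neqAle eq_sym w0 cylinder_weight_ge0.
have := ge _ _ l_gt0 wpos; rewrite /cond_prob hist.
have -> : s (size l).+1 = b by rewrite /s subnn.
have -> : s (size l) = head true l.
  by rewrite /s subSn // subnn /=; case: l l0 {s l_gt0 hist w0 wpos}.
rewrite setIC -cylinder_cons -!/(cylinder_weight _) => <-.
by rewrite mulrC divfK.
Qed.

(** Markov's inequality: the event is a finite union of cylinders, over words with
    [F l / c >= 1]. *)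
Lemma markov_words n (F : seq bool -> R) (c : R) : 0 < c ->
  (forall l, 0 <= F l) ->
  measurable [set w | c <= F (past (fun t => X t w) n)] /\
  (P [set w | (c <= F (past (fun t => X t w) n))%R] <=
   (c^-1 * word_expect cylinder_weight n F)%:E)%E.
Proof.
move=> c_gt0 F_ge0.
have -> : [set w | c <= F (past (fun t => X t w) n)] =
    \big[setU/set0]_(l <- words n | c <= F l) cylinder l.
  rewrite -bigcup_seq_cond; apply/seteqP; split => w /=.
    move=> cF; exists (past (fun t => X t w) n).
      by rewrite /= mem_words size_past eqxx.
    by rewrite /cylinder /= size_past.
  by case=> l /=; rewrite mem_words => /andP [/eqP <- cF] ->.
split; first by apply: bigsetU_measurable => l _; exact: measurable_cylinder.
rewrite /word_expect; elim: (words n) => [|l ws IH].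
  by rewrite !big_nil measure0 mulr0.
rewrite !big_cons mulrDr EFinD; case: ifP => cF; last first.
  apply: le_trans IH _; rewrite leeDr // lee_fin mulr_ge0 ?invr_ge0 ?(ltW c_gt0) //.
  by rewrite mulr_ge0 ?cylinder_weight_ge0.
apply: le_trans (measureU2 _ _ _) _; first exact: measurable_cylinder.
  by apply: bigsetU_measurable => ? _; exact: measurable_cylinder.
apply: leeD; last exact: IH.
apply: (@le_trans _ _ (cylinder_weight l)%:E); first by rewrite -cylinder_weightE.
rewrite lee_fin mulrCA.
by rewrite ler_peMr ?cylinder_weight_ge0 // ler_pdivlMl // mulr1.
Qed.

End PathMeasure.

(** * Borel-Cantelli and the almost sure limit *)

Lemma sum_inv_sq_le (R : realType) n :
  \sum_(0 <= k < n) (k.+1%:R ^+ 2)^-1 <= 2 :> R.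
Proof.
(* The sharper bound makes the induction telescope. *)
have bound m : \sum_(0 <= k < m.+1) (k.+1%:R ^+ 2)^-1 <= 2 - m.+1%:R^-1 :> R.
  elim: m => [|m IH]; first by rewrite big_nat1 expr1n invr1; lra.
  rewrite big_nat_recr //=; apply: le_trans (lerD IH (lexx _)) _.
  rewrite -(natr1 m.+1); set x : R := m.+1%:R.
  have x_gt0 : 0 < x by rewrite ltr0n.
  have x1_gt0 : 0 < x + 1 by rewrite addr_gt0.
  rewrite -subr_ge0.
  have -> : 2 - (x + 1)^-1 - (2 - x^-1 + ((x + 1) ^+ 2)^-1) =
      (x * (x + 1) ^+ 2)^-1.
    by field; rewrite !gt_eqF.
  by rewrite invr_ge0 mulr_ge0 ?exprn_ge0 // ltW.
case: n => [|n]; first by rewrite big_geq.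
by apply: le_trans (bound n) _; rewrite gerBl.
Qed.

Lemma borel_cantelli_inv_sq (R : realType) (d : measure_display)
    (Omega : measurableType d) (P : probability Omega R)
    (E : nat -> set Omega) (K : R) : 0 <= K ->
  (forall k, measurable (E k)) ->
  (forall k, (P (E k) <= (K / k.+1%:R ^+ 2)%:E)%E) ->
  {ae P, forall w, exists k0, forall k, (k0 <= k)%N -> ~ E k w}.
Proof.
move=> K_ge0 mE PE; exists (lim_sup_set E); split.
- by apply: bigcapT_measurable => n; apply: bigcup_measurable.
- apply: lim_sup_set_cvg0 => //.
  apply: (@le_lt_trans _ _ (K * 2)%:E); last exact: ltry.
  apply: lime_le; first exact: is_cvg_nneseries.
  apply: nearW => n; apply: (@le_trans _ _ (\sum_(0 <= k < n) (K / k.+1%:R ^+ 2)%:E)%E).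
    by apply: lee_sum => k _; exact: PE.
  rewrite sumEFin lee_fin -mulr_sumr ler_wpM2l //; exact: sum_inv_sq_le.
- move=> w /= h n _; apply: contrapT => hn; apply: h; exists n => k nk Ek.
  by apply: hn; exists k.
Qed.

Theorem lemma3 (R : realType) (d : measure_display) (Omega : measurableType d)
  (P : probability Omega R) (p r : R) (X : nat -> {RV P >-> bool})
  (a0 : nat -> R) :
  0 < p < 1 -> 0 < r < 1 ->
  gilbert_elliott p r X ->
  {ae P, forall w,
    time_average_age a0 (fun t => X t w) tau @[tau --> \oo] -->
    1 + p / r + p / (r * (p + r))}.
Proof.
move=> p01 r01 ge.
have [r_gt0 _] := andP r01; have [p_gt0 _] := andP p01.
have mean_ge0 : 0 <= mean_age p r.
  by rewrite /mean_age !addr_ge0 // divr_ge0 ?mulr_ge0 ?addr_ge0 // ltW.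
have [K K_ge0 EK] := word_expect_centered_sq p01 r01
  (cylinder_weight_nil X) (cylinder_weight_ge0 X)
  (fun b l => cylinder_weight_cons b ge) (cylinder_weight_split X).
pose dev n l := ((age_sum l)%:R - mean_age p r * n%:R) ^+ 2 : R.
(* At [n = (k+1)^4] the second moment is at most [K (k+1)^4]; the squared threshold [(k+1)^6] leaves
   the summable bound [K / (k+1)^2]. *)
pose E k := [set w | k.+1%:R ^+ 6 <=
  dev (k.+1 ^ 4)%N (past (fun t => X t w) (k.+1 ^ 4)%N)].
have EP k : measurable (E k) /\ (P (E k) <= (K / k.+1%:R ^+ 2)%:E)%E.
  have k6 : 0 < k.+1%:R ^+ 6 :> R by rewrite exprn_gt0 // ltr0n.
  have [mE PE] := markov_words X (k.+1 ^ 4)%N k6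
    (fun l => sqr_ge0 ((age_sum l)%:R - mean_age p r * (k.+1 ^ 4)%N%:R)).
  split=> //; apply: le_trans PE _; rewrite lee_fin ler_pdivrMl //.
  have [n en] : exists n, (k.+1 ^ 4)%N = n.+1.
    by exists (k.+1 ^ 4).-1; rewrite prednK // expn_gt0.
  rewrite en; apply: le_trans (EK n) _; rewrite -en natrX.
  rewrite le_eqVlt; apply/orP; left; apply/eqP.
  have : k.+1%:R != 0 :> R by rewrite pnatr_eq0.
  by move: (k.+1%:R : R) => x x0; field.
have := borel_cantelli_inv_sq K_ge0 (fun k => (EP k).1) (fun k => (EP k).2).
apply: filterS => w [k0 hk0]; apply: time_average_age_cvg.
apply: average_cvg_fourth_powers => //.
  move=> m n mn; rewrite -(subnK mn); elim: (n - m)%N => //= i IH.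
  exact: leq_trans IH (leq_addr _ _).
exists k0.+1 => -[//|k] k0k; rewrite leNgt; apply/negP => h.
apply: (hk0 k k0k); rewrite /E /dev /= -real_normK ?num_real //.
by rewrite (exprM _ 3 2) ler_pXn2r ?nnegrE ?exprn_ge0 // ltW.
Qed.
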